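(* Let $p$ be a prime with $p\equiv 3\pmod 4$ and $p\ge7$. Then there exists a tight $\mathrm{PTE}_p$ solution of degree $2$ for the binary sphere $\Omega=S_{(p-1)/2}^{p-1}$.
   Context: The binary sphere is $S_k^{r-1}=\{(x_1,\ldots,x_r)\in\{0,1\}^r:\sum x_i^2=k\}$. For multisets $A=\{\mathbf{a}_1,\ldots,\mathbf{a}_n\}$, $B=\{\mathbf{b}_1,\ldots,\mathbf{b}_n\}\subset\mathbb{Q}^r$ with $\mathbf{a}_i=(a_{i1},\ldots,a_{ir})$, $\mathbf{b}_i=(b_{i1},\ldots,b_{ir})$, $(A,B)$ is a $\mathrm{PTE}_r$ solution of degree $m$ and size $n$ if $A,B$ have no common element and $\sum_i\prod_j a_{ij}^{k_j}=\sum_i\prod_j b_{ij}^{k_j}$ for all nonnegative integers $k_j$ with $1\le\sum_j k_j\le m$. For $\Omega\subseteq\mathbb{Q}^r$, $\mathcal{P}_t(\Omega)$ is the $\mathbb{Q}$-space of restrictions to $\Omega$ of rational polynomials of degree $\le t$; given a basis $\mathbf{t}_1,\ldots,\mathbf{t}_d$ of it, $N_A=(\mathbf{t}_i(\mathbf{a}_j))$ and $N_B=(\mathbf{t}_i(\mathbf{b}_j))$. A $\mathrm{PTE}_r$ solution $(A,B)$ with $A,B\subseteq\Omega$ of degree $2t$ and size $n$ is tight (for $\Omega$) if $n=\operatorname{rank}[N_A\;N_B]=\dim_{\mathbb{Q}}\mathcal{P}_t(\Omega)$. *)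

(* Defs.v *)
From mathcomp Require Export all_boot all_order all_algebra.
From mathcomp Require Export mpoly.

Set Implicit Arguments.
Unset Strict Implicit.
Unset Printing Implicit Defensive.

Import GRing.Theory.
Local Open Scope ring_scope.

(* The binary sphere S_k^{r-1}: the dimension r of the ambient space, not r-1,
   is the index. *)
Definition binary_sphere (r k : nat) : {pred 'rV[rat]_r} :=
  fun x => [forall j, (x 0 j == 0) || (x 0 j == 1)]
           && (\sum_(j < r) x 0 j ^+ 2 == k%:R).
Arguments binary_sphere : clear implicits.

(* Multisets of size n are represented by n-tuples; every notion below is
   invariant under permutation of the tuples. *)
Definition PTE_solution (r m n : nat) (A B : n.-tuple 'rV[rat]_r) : Prop :=
  (forall x, x \in A -> x \notin B) /\
  (forall k : 'I_r -> nat, (1 <= \sum_(j < r) k j <= m)%N ->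
     \sum_(i < n) \prod_(j < r) tnth A i 0 j ^+ k j
     = \sum_(i < n) \prod_(j < r) tnth B i 0 j ^+ k j).

(* Elements of P_t(Omega) are represented by functions on the whole of Q^r that
   are only ever compared on Omega. [msize p <= t.+1] means deg p <= t. *)
Definition in_Pt (r t : nat) (Omega : {pred 'rV[rat]_r})
    (f : 'rV[rat]_r -> rat) : Prop :=
  exists p : {mpoly rat[r]},
    (msize p <= t.+1)%N /\ {in Omega, forall x, f x = p.@[x 0]}.

Definition basis_Pt (r t : nat) (Omega : {pred 'rV[rat]_r}) (d : nat)
    (T : 'I_d -> 'rV[rat]_r -> rat) : Prop :=
  [/\ forall i, in_Pt t Omega (T i),
      forall c : 'I_d -> rat,
        {in Omega, forall x, \sum_(i < d) c i * T i x = 0} ->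
        forall i, c i = 0
    & forall f, in_Pt t Omega f ->
        exists c : 'I_d -> rat,
          {in Omega, forall x, f x = \sum_(i < d) c i * T i x}].

Definition eval_mx (r d n : nat) (T : 'I_d -> 'rV[rat]_r -> rat)
    (A : n.-tuple 'rV[rat]_r) : 'M[rat]_(d, n) :=
  \matrix_(i < d, j < n) T i (tnth A j).

(* A finite basis of P_t(Omega) always exists and, for A, B in Omega, neither d
   nor the rank depends on its choice. *)
Definition tight_PTE (r t n : nat) (Omega : {pred 'rV[rat]_r})
    (A B : n.-tuple 'rV[rat]_r) : Prop :=
  [/\ PTE_solution (2 * t) A B,
      {subset A <= Omega},
      {subset B <= Omega}
    & exists (d : nat) (T : 'I_d -> 'rV[rat]_r -> rat),
        [/\ basis_Pt t Omega T,
            n = \rank (row_mx (eval_mx T A) (eval_mx T B))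
          & n = d]].

(* Main.v *)
Require Import Defs.
From mathcomp Require Import all_field zify ring.

Set Implicit Arguments.
Unset Strict Implicit.
Unset Printing Implicit Defensive.

Import GRing.Theory Num.Theory.
Local Open Scope ring_scope.

(** In a field of order q = 3 (mod 4) the nonzero squares Q satisfy
    F* = Q + (-Q) (disjoint union).  Take for A the indicator vectors of the
    translates s + Q and for B those of s - Q.  The substitution s -> x + y - s
    exchanges the blocks of A and of B that contain x and y, which gives equality
    of all moments of degree at most 2.  The sum of the incidence matrices of A
    and B is J - I, so [N_A N_B] has full rank q in the basis of the q coordinate
    functions; these span P_1 because the sum of the coordinates is a nonzero
    constant on the sphere.  Finally s + Q = t - Q would force s <> t and
    1 + e^2 in -Q for every e <> 0, so that 2, 5 and 10 = 2 * 5 all lie in -Q. *)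

Section Skew.

Variables (F : finFieldType) (Q : pred F).
Hypothesis Q0 : Q 0 = false.
Hypothesis Q1 : Q 1.
Hypothesis QM : forall x y, Q x -> Q y -> Q (x * y).
Hypothesis QN : forall x, x != 0 -> Q (- x) = ~~ Q x.

Lemma skew_asym x : Q x -> Q (- x) -> False.
Proof.
move=> Qx; have [x0|xn0] := eqVneq x 0; first by rewrite x0 Q0 in Qx.
by rewrite QN // Qx.
Qed.

Lemma skew_sqr e : e != 0 -> Q (e ^+ 2).
Proof.
move=> en0; have [Qe|nQe] := boolP (Q e); first by rewrite expr2 QM.
by rewrite -sqrrN expr2 QM // QN.
Qed.

(** Negation exchanges [Q] with its complement in F*, so twice the size of [Q] is the number of
    nonzero elements. With [f] a translation or reflection this puts every block on the sphere. *)
Lemma skew_sum (f : F -> F) : bijective f ->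
  (\sum_(x : F) (Q (f x) : nat) = (#|F| - 1) %/ 2)%N.
Proof.
move=> bf; rewrite -(@reindex _ _ _ _ _ f predT (fun x => (Q x : nat))) /=; last first.
  exact: onW_bij.
set S := (\sum_x _)%N.
have SN : (S = \sum_(x : F) (Q (- x) : nat))%N.
  by rewrite /S (reindex_inj (@oppr_inj F)).
suff -> : (#|F| - 1 = S + S)%N by rewrite addnn -muln2 mulnK.
rewrite {2}SN -big_split /= (bigD1 0) //= oppr0 Q0 add0n.
rewrite (eq_bigr (fun _ => 1%N)) => [|x xn0]; last by rewrite QN //; case: (Q x).
by rewrite sum1_card cardC1 subn1.
Qed.

Lemma skew_translate_neq (s t : F) : (2%:R : F) != 0 -> (3%:R : F) != 0 ->
  ~ (forall x, Q (x - s) = Q (t - x)).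
Proof.
move=> n2 n3 E; pose c := t - s.
have Ec y : Q y = Q (c - y).
  by rewrite -{1}(addrK s y) E; congr Q; rewrite /c; ring.
have cn0 : c != 0.
  apply/eqP => c0; move: (Ec 1); rewrite Q1 c0 sub0r => /esym.
  exact: skew_asym.
have QNc : Q (- c) by rewrite QN // Ec subrr Q0.
(* Since [- c] and [e ^+ 2] lie in [Q], so does their product, and the reflection [y -> c - y] sends
   it to [c * (1 + e ^+ 2)]. If [1 + e ^+ 2] were in [Q], multiplying it by [- c] would put the
   opposite element in [Q] as well. *)
have key e : e != 0 -> Q (- (1 + e ^+ 2)).
  move=> en0.
  have h : Q (c * (1 + e ^+ 2)).
    by rewrite mulrDr mulr1 -[c * e ^+ 2]opprK -mulNr -Ec QM // skew_sqr.
  rewrite QN.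
    by apply/negP => h'; apply: (skew_asym h); rewrite -mulNr; apply: QM.
  by apply/eqP => e0; rewrite e0 mulr0 Q0 in h.
have Q2 := key _ (oner_neq0 F).
have Q5 := key _ n2.
(* The case e = 3 needs 3 to be nonzero: over F_3 with Q = {1}, the blocks 1 + Q and 0 - Q
   coincide. *)
have Q10 := key _ n3.
apply: (skew_asym (QM Q2 Q5)); move: Q10; congr (is_true (Q _)); ring.
Qed.

Lemma skew_pair_count (x y : F) :
  \sum_(s : F) (Q (x - s))%:R * (Q (y - s))%:R
  = \sum_(s : F) (Q (s - x))%:R * (Q (s - y))%:R :> rat.
Proof.
rewrite (reindex_inj (inv_inj (subKr (x + y)))) /=.
apply: eq_bigr => s _; rewrite mulrC; congr ((Q _)%:R * (Q _)%:R); ring.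
Qed.

End Skew.

(** Euler's criterion makes this [Q] the set of nonzero squares. For nonzero [x] the power [x ^+ h]
    is 1 or -1, and negating [x] flips its sign because [h] is odd. *)
Lemma half_power_skew (F : finFieldType) (h : nat) :
  odd h -> #|F| = h.*2.+1 -> (2%:R : F) != 0 ->
  let Q := fun x : F => x ^+ h == 1 in
  [/\ Q 0 = false, Q 1, forall x y, Q x -> Q y -> Q (x * y)
    & forall x, x != 0 -> Q (- x) = ~~ Q x].
Proof.
move=> oh cF n2 Q; rewrite /Q; split=> [||x y /eqP Ex /eqP Ey|x xn0].
- by rewrite expr0n; case: h oh {cF Q} => //= h _; rewrite eq_sym oner_eq0.
- by rewrite expr1n.
- by rewrite exprMn Ex Ey mulr1.
have n11 : (-1 == 1 :> F) = false.
  by apply: contra_neqF n2 => /eqP e; rewrite mulr2n -{1}e addNr.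
have : (x ^+ h) ^+ 2 == 1.
  apply/eqP; rewrite -exprM muln2; apply: (mulfI xn0).
  by rewrite -exprS -cF expf_card mulr1.
rewrite sqrf_eq1 exprNn -signr_odd oh expr1 mulN1r.
by case/orP => /eqP ->; rewrite ?opprK eqxx n11.
Qed.

Lemma expr_binary (x : rat) k : (x == 0) || (x == 1) -> (0 < k)%N -> x ^+ k = x.
Proof.
by case/orP => /eqP -> k0; rewrite ?expr1n // expr0n; case: k k0.
Qed.

(** Positive powers of 0 and 1 collapse, so only the variables that occur matter; a single variable
    is covered by i = j. All moments thus reduce to pair counts. *)
Lemma binary_monomial_deg2 r (k : 'I_r -> nat) : (1 <= \sum_(j < r) k j <= 2)%N ->
  exists i j, forall x : 'rV[rat]_r, (forall l, (x 0 l == 0) || (x 0 l == 1)) ->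
    \prod_(l < r) x 0 l ^+ k l = x 0 i * x 0 j.
Proof.
case/andP; rewrite lt0n sum_nat_eq0 negb_forall => /existsP[i /=].
rewrite -lt0n => ki; rewrite (bigD1 i) //= => le2.
have [z|] := eqVneq (\sum_(l < r | l != i) k l)%N 0%N.
  exists i, i => x bx; rewrite (bigD1 i) //= big1 ?mulr1.
    by rewrite expr_binary // -expr2 expr_binary.
  move/eqP: z; rewrite sum_nat_eq0 => /forallP z l li.
  by move: (z l); rewrite li => /eqP ->.
rewrite sum_nat_eq0 negb_forall => /existsP[j].
rewrite negb_imply -lt0n => /andP[ji kj].
exists i, j => x bx; rewrite (bigD1 i) //= (bigD1 j) //= big1 ?mulr1.
  by rewrite !expr_binary.
move: le2; rewrite (bigD1 j) //=; set S := (\sum_(l < r | _) k l)%N => le2.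
have /eqP : S = 0%N by move: ki kj le2; clearbody S; lia.
rewrite sum_nat_eq0 => /forallP z l lij.
by move: (z l); rewrite lij => /eqP ->.
Qed.

Lemma affine_on_sphere r k (f : 'rV[rat]_r -> rat) : (0 < k)%N ->
  in_Pt 1 (binary_sphere r k) f ->
  exists c : 'I_r -> rat,
    {in binary_sphere r k, forall x, f x = \sum_(i < r) c i * x 0 i}.
Proof.
move=> k0 [p [sp fp]].
suff [c Ec] : exists c : 'I_r -> rat, {in binary_sphere r k, forall x : 'rV_r,
    (\sum_(m <- msupp p) p@_m *: 'X_[m]).@[x 0] = \sum_(i < r) c i * x 0 i}.
  by exists c => x xS; rewrite fp // [p]mpolyE Ec.
have : forall m, m \in msupp p -> (mdeg m <= 1)%N.
  by move=> m mp; rewrite -ltnS; apply: leq_trans sp; apply: msize_mdeg_lt.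
elim: (msupp p) => [|m s IHs] ms.
  by exists (fun _ => 0) => x _; rewrite big_nil meval0 big1 // => i _; rewrite mul0r.
have [c Ec] : exists c : 'I_r -> rat, {in binary_sphere r k, forall x : 'rV_r,
    (\sum_(m <- s) p@_m *: 'X_[m]).@[x 0] = \sum_(i < r) c i * x 0 i}.
  by apply: IHs => m' m's; apply: ms; rewrite inE m's orbT.
have [d Ed] : exists d : 'I_r -> rat, {in binary_sphere r k, forall x : 'rV_r,
    'X_[m].@[x 0] = \sum_(i < r) d i * x 0 i}.
  have := ms m (mem_head _ _); rewrite leq_eqVlt ltnS leqn0.
  case/orP => [/mdeg1P[i /eqP ->]|].
    exists (fun j => (j == i)%:R) => x _; rewrite mevalXU (bigD1 i) //= eqxx mul1r.
    by rewrite big1 ?addr0 // => j /negPf ->; rewrite mul0r.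
  (* On the sphere the coordinates equal their squares and hence sum to [k], so the constant 1 is
     [k%:R^-1] times their sum. *)
  rewrite mdeg_eq0 => /eqP ->; exists (fun _ => k%:R^-1) => x.
  rewrite unfold_in => /andP[/forallP bx /eqP Sx].
  rewrite mpolyX0 meval1 -mulr_sumr.
  rewrite (eq_bigr (fun j => x 0 j ^+ 2)) => [|j _]; last by rewrite expr_binary.
  by rewrite Sx mulVf // pnatr_eq0 -lt0n.
exists (fun i => p@_m * d i + c i) => x xS.
rewrite big_cons mevalD mevalZ Ed // Ec // mulr_sumr -big_split /=.
by apply: eq_bigr => i _; rewrite mulrDl mulrA.
Qed.

(** This is the injectivity of J - I: every [c i] equals the total [S], whence [S] = n [S]. *)
Lemma sum_compl_eq0 (n : nat) (c : 'I_n -> rat) : n != 1%N ->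
  (forall s, \sum_(i < n | i != s) c i = 0) -> forall i, c i = 0.
Proof.
move=> n1 E; set S := \sum_i c i.
have cS i : c i = S by rewrite /S (bigD1 i) //= E addr0.
have /eqP : S * (n%:R - 1) = 0.
  rewrite mulrBr mulr1 mulr_natr -{1}[n]card_ord -sumr_const.
  by rewrite -(eq_bigr _ (fun i _ => cS i)) subrr.
by rewrite mulf_eq0 subr_eq0 pnatr_eq1 (negPf n1) orbF => /eqP S0 i; rewrite cS.
Qed.

Lemma tight_PTE_finField (F : finFieldType) (h : nat) :
  odd h -> #|F| = h.*2.+1 -> (2%:R : F) != 0 -> (3%:R : F) != 0 ->
  exists A B : #|F|.-tuple 'rV[rat]_#|F|,
    tight_PTE 1 (binary_sphere #|F| ((#|F| - 1) %/ 2)) A B.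
Proof.
move=> oh cF n2 n3.
have := half_power_skew oh cF n2; set Q := (fun x : F => _) => -[Q0 Q1 QM QN].
pose a (s : F) : 'rV[rat]_#|F| := \row_j (Q (enum_val j - s))%:R.
pose b (s : F) : 'rV[rat]_#|F| := \row_j (Q (s - enum_val j))%:R.
pose A := [tuple a (enum_val i) | i < #|F|].
pose B := [tuple b (enum_val i) | i < #|F|].
have ab s t : a s <> b t.
  move=> E; apply: (@skew_translate_neq F Q Q0 Q1 QM QN s t n2 n3) => x.
  move/rowP: E => /(_ (enum_rank x)); rewrite !mxE !enum_rankK => /eqP.
  by rewrite eqr_nat; case: (Q _); case: (Q _).
have bin (u : bool) : ((u%:R == 0 :> rat) || (u%:R == 1 :> rat)) by case: u.
have sphere (f : F -> F) : bijective f ->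
    (\row_j (Q (f (enum_val j)))%:R : 'rV[rat]_#|F|)
      \in binary_sphere #|F| ((#|F| - 1) %/ 2).
  move=> bf; rewrite unfold_in; apply/andP; split.
    by apply/forallP => j; rewrite mxE.
  rewrite -(skew_sum Q0 QN bf) natr_sum (reindex (@enum_val F predT)) /=; last first.
    exact/onW_bij/enum_val_bij.
  by apply/eqP/eq_bigr => j _; rewrite mxE expr_binary.
have aS s : a s \in binary_sphere #|F| ((#|F| - 1) %/ 2).
  by apply: (sphere (fun x => x - s)); exists (fun x => x + s) => x;
    rewrite ?subrK ?addrK.
have bS s : b s \in binary_sphere #|F| ((#|F| - 1) %/ 2).
  by apply: (sphere (fun x => s - x)); exists (fun x => s - x) => x; rewrite subKr.
have abE (s i : 'I_#|F|) :
    a (enum_val s) 0 i + b (enum_val s) 0 i = (i != s)%:R.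
  rewrite !mxE -opprB; have [->|ns] := eqVneq i s; first by rewrite subrr oppr0 Q0.
  rewrite QN; last by rewrite subr_eq0 (inj_eq enum_val_inj) eq_sym.
  by case: (Q _).
(* Used twice: for the independence of the coordinate functions on the sphere, and for the rank of
   the joint evaluation matrix, whose left kernel consists of such relations. *)
have indep (c : 'I_#|F| -> rat) :
    (forall s, \sum_(i < #|F|) c i * a s 0 i = 0) ->
    (forall s, \sum_(i < #|F|) c i * b s 0 i = 0) -> forall i, c i = 0.
  move=> Ea Eb; apply: sum_compl_eq0 => [|s].
    by rewrite cF eqSS double_eq0 -lt0n odd_gt0.
  have := congr2 +%R (Ea (enum_val s)) (Eb (enum_val s)).
  rewrite -big_split addr0 /= => E; rewrite -[RHS]E big_mkcond; apply: eq_bigr => i _.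
  by rewrite -mulrDr abE; case: eqP; rewrite ?mulr0 ?mulr1.
exists A, B; split.
- split=> [x /tnthP[i ->]|k kle].
    rewrite tnth_mktuple; apply/negP => /tnthP[j]; rewrite tnth_mktuple.
    exact: ab.
  have [i [j Eij]] := binary_monomial_deg2 kle.
  under eq_bigr => s _.
    rewrite tnth_mktuple Eij; last by move=> l; rewrite mxE.
    rewrite !mxE; over.
  under [RHS]eq_bigr => s _.
    rewrite tnth_mktuple Eij; last by move=> l; rewrite mxE.
    rewrite !mxE; over.
  have := skew_pair_count Q (enum_val i) (enum_val j).
  by rewrite !(reindex (@enum_val F predT)) //=; apply/onW_bij/enum_val_bij.
- by move=> x /tnthP[i ->]; rewrite tnth_mktuple.
- by move=> x /tnthP[i ->]; rewrite tnth_mktuple.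
exists #|F|, (fun i x => x 0 i); split=> //.
  split=> [i|c Ec|f].
  - by exists 'X_i; rewrite msizeX mdeg1; split=> // x _; rewrite mevalXU.
  - by apply: indep => s; apply: Ec.
  - by apply: affine_on_sphere; rewrite cF subn1 /= -muln2 mulnK // odd_gt0.
apply/esym/eqP/inj_row_free => v; rewrite mul_mx_row -row_mx0 => /eq_row_mx[Ea Eb].
apply/rowP => i; rewrite [RHS]mxE; apply: indep => s.
  move/rowP: Ea => /(_ (enum_rank s)); rewrite !mxE => Ea; rewrite -[RHS]Ea.
  by apply: eq_bigr => j _; rewrite [_ _ (enum_rank s)]mxE tnth_mktuple enum_rankK.
move/rowP: Eb => /(_ (enum_rank s)); rewrite !mxE => Eb; rewrite -[RHS]Eb.
by apply: eq_bigr => j _; rewrite [_ _ (enum_rank s)]mxE tnth_mktuple enum_rankK.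
Qed.

Local Close Scope ring_scope.

Theorem theorem3p6 (p : nat) (hp : prime p) (hp4 : p = 3 %[mod 4])
    (hp7 : 7 <= p) :
  exists (n : nat) (A B : n.-tuple 'rV[rat]_p),
    tight_PTE 1 (binary_sphere p ((p - 1) %/ 2)) A B.
Proof.
have cF : #|'F_p| = p := card_Fp hp.
have nz k : (0 < k < p)%N -> (k%:R != 0 :> 'F_p)%R.
  move=> /andP[k0 kp]; rewrite -(dvdn_pcharf (pchar_Fp hp)).
  by rewrite gtnNdvd.
(* As [p] is 3 modulo 4, it is odd and [p %/ 2] is (p - 1)/2, itself odd. *)
have E : p = (p %/ 2).*2.+1 by lia.
have oh : odd (p %/ 2) by lia.
have := @tight_PTE_finField 'F_p (p %/ 2) oh (etrans cF E).
by rewrite cF => /(_ (nz 2 ltac:(lia)) (nz 3 ltac:(lia))); exists p.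
Qed.
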